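(* Assume that the Boolean algebra $\mathcal{P}(\mathbb{N})$ is $(\aleph_1,\aleph_0)$-ideal. If $X$ is a compact space with a countable dense set $D$ such that every infinite subset of $D$ contains a converging subsequence, then $X$ does not map continuously onto $[0,1]^{\omega_2}$.
   Context: Compact spaces are Hausdorff. A subalgebra $A$ of a Boolean algebra $B$ is \emph{$\aleph_0$-ideal} if for each $b\in B\setminus A$ the ideal $\{a\in A: a<b\}$ of $A$ has a countable cofinal subset. A Boolean algebra $B$ is \emph{$(\aleph_1,\aleph_0)$-ideal} if there is a family $\mathcal{A}$ of $\aleph_0$-ideal subalgebras of $B$, each of cardinality $\aleph_1$, such that every subset of $B$ of size $\aleph_1$ is contained in some member of $\mathcal{A}$ and the union of each chain from $\mathcal{A}$ of cofinality $\omega_1$ is again in $\mathcal{A}$. *)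

(* Defs.v *)
From mathcomp Require Import all_boot all_order all_algebra.
From mathcomp Require Import all_classical all_reals all_analysis.

Set Implicit Arguments.
Unset Strict Implicit.
Unset Printing Implicit Defensive.

Local Open Scope classical_set_scope.
Local Open Scope card_scope.

(* B has the least cardinality larger than that of A; by choice it is enough *)
(* to compare with the subsets of B.                                         *)
Definition is_card_succ T U (A : set T) (B : set U) : Prop :=
  [/\ A #<= B, ~ (B #<= A) &
      forall C : set U, C `<=` B -> C #<= A \/ C #= B].

Fixpoint has_card_aleph (n : nat) T (A : set T) : Prop :=
  if n is m.+1 then
    exists2 B : set T, has_card_aleph m B & is_card_succ B A
  else A #= [set: nat].

Definition cofinal_in T (R : T -> T -> Prop) (P Q : set T) : Prop :=
  Q `<=` P /\ forall x, P x -> exists2 y, Q y & R x y.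

(* Meant for P linearly ordered by R, where the cofinality is the least      *)
(* cardinality of a cofinal subset.                                          *)
Definition has_cofinality_omega1 T (R : T -> T -> Prop) (P : set T) : Prop :=
  exists2 Q : set T, cofinal_in R P Q /\ has_card_aleph 1 Q &
    forall Q' : set T, cofinal_in R P Q' -> Q #<= Q'.

Section BooleanAlgebra.
Context {d : Order.disp_t} {B : ctbDistrLatticeType d}.
Implicit Types A S : set B.

Definition is_subalgebra A : Prop :=
  [/\ A (\bot)%O, A (\top)%O,
      forall a b, A a -> A b -> A (a `&` b)%O,
      forall a b, A a -> A b -> A (a `|` b)%O &
      forall a, A a -> A (~` a)%O].

Definition aleph0_ideal_subalgebra A : Prop :=
  is_subalgebra A /\
  forall b, ~ A b ->
    exists2 Q : set B, countable Q &
      cofinal_in (fun x y => (x <= y)%O) [set a | A a /\ (a < b)%O] Q.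

Definition aleph1_aleph0_ideal_family (F : set (set B)) : Prop :=
  [/\ forall A, F A -> aleph0_ideal_subalgebra A,
      forall A, F A -> has_card_aleph 1 A,
      forall S, has_card_aleph 1 S -> exists2 A, F A & S `<=` A &
      forall C : set (set B), C `<=` F -> total_on C subset ->
        has_cofinality_omega1 subset C -> F (\bigcup_(A in C) A)].

End BooleanAlgebra.

Definition aleph1_aleph0_ideal d (B : ctbDistrLatticeType d) : Prop :=
  exists F : set (set B), aleph1_aleph0_ideal_family F.

(* The terms of the subsequence are pairwise distinct: constant sequences    *)
(* would otherwise satisfy the condition.                                    *)
Definition contains_converging_subsequence (X : topologicalType) (S : set X) :
    Prop :=
  exists u : nat -> X,
    [/\ injective u, forall n, S (u n) & exists x : X, u @ \oo --> x].

(* Main.v *)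
Require Import Defs.
From mathcomp Require Import all_boot all_order all_algebra.
From mathcomp Require Import all_classical all_reals all_analysis.
From mathcomp Require Import lra.
From Stdlib Require Inverse_Image.
Import Order.TTheory GRing.Theory Num.Theory.
Import numFieldNormedType.Exports.
Local Open Scope classical_set_scope.
Local Open Scope ring_scope.

(** Suppose that f maps X continuously onto the cube, and enumerate D as
    d 0, d 1, ... (possibly with repetitions). Each coordinate i of f gives two
    sets of natural numbers, b true i = {n | f (d n) i < 2/3} and
    b false i = {n | 1/3 < f (d n) i}, whose union is everything. As f is onto
    and D is dense, the pairs are independent: finitely many of the sets
    b true i and, for other coordinates, finitely many of the sets b false j can
    be avoided simultaneously ([independent_cover]).

    The proof plays two facts against each other. Say that i decides p when p is
    contained in b true i or in b false i.

    First, a countable family P of sets of natural numbers can be trapped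
    ([convergent_trap]): there is a sequence u in D, convergent in X, such that,
    for all coordinates i outside a countable set, no tail of u (pulled back to
    the indices) is contained in a member of P decided by i. Indeed, a finite
    subfamily of P covering the natural numbers and consisting of sets decided
    by some coordinates cannot be decided again by coordinates disjoint from the
    first ones, by independence. There are only countably many finite
    subfamilies, so that discarding countably many coordinates leaves no such
    finite cover at all ([avoid_decided_sets]). Then a sequence can be chosen
    that leaves every decided member of P, and it has a convergent subsequence.
    On the other hand, convergence makes the coordinate i of f converge along u,
    so that every coordinate decides some tail of u.

    Second, the hypothesis on the algebra of all sets of natural numbers yields
    a member A of the family which is the union of a chain of length omega_1 and
    therefore can be closed off ([exists_closed_member]): aleph_1 many countable
    subsets P of A are cofinal among all its countable subsets, and A contains
    the tails of the trap of each of these P.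

    Only aleph_1 many coordinates are discarded by these traps, so some
    coordinate i is discarded by none. The sets b true i and b false i dominate
    ideals of A with countable cofinal subsets, and some P contains both of
    these subsets. A tail of the trap of P is contained in b true i or in
    b false i and belongs to A, so it is contained in a member of P decided by
    i: a contradiction ([aleph1_aleph0_ideal_no_traps]). *)

Set Implicit Arguments.
Unset Strict Implicit.

Local Open Scope card_scope.

(** * Cardinality and well-founded recursion *)

(** A witness in U lets the injection be an honest function on all of T; without
    one there may be no function from T to U even if A is empty. *)
Lemma card_le_exP T U (A : set T) (B : set U) (u0 : U) :
  A #<= B <-> exists2 f : T -> U, (forall x, A x -> B (f x)) &
    forall x y, A x -> A y -> f x = f y -> x = y.
Proof.
elim/Ppointed: U => U in B u0 *; first by have := no u0.
split=> [/pcard_leP/injfunPex[f fAB finj]|[f fAB finj]].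
  by exists f => // x y Ax Ay; apply: finj; rewrite inE.
apply/pcard_leP/injfunPex; exists f => // x y /set_mem Ax /set_mem Ay.
exact: finj.
Qed.

Lemma card_eqW T U (A : set T) (B : set U) : A #= B -> A #<= B.
Proof. by rewrite card_eq_le => /andP[]. Qed.

Lemma countable_range T (P : set T) : countable P -> P !=set0 ->
  exists e : nat -> T, P = range e.
Proof.
by move=> /pfcard_geP[->[x //]|/surjfunPex[e ->] _]; exists e.
Qed.

Lemma countableU T (A B : set T) : countable A -> countable B ->
  countable (A `|` B).
Proof.
move=> cA cB; rewrite -bigcup2E; apply: bigcup_countable => // i _.
by case: i => [|[|i]] //=.
Qed.

(** Transfinite recursion where every step makes a choice: the value at w is
    only required to be related by Phi to the values already chosen below w. *)
Lemma wf_choice (W Z : Type) (lt : W -> W -> Prop)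
    (Phi : forall w, (forall v, lt v w -> Z) -> Z -> Prop) :
  well_founded lt -> (forall w g, exists z, Phi w g z) ->
  exists G : W -> Z, forall w, Phi w (fun v _ => G v) (G w).
Proof.
move=> wf ex; pose step w g := projT1 (cid (ex w g)).
exists (Fix wf (fun=> Z) step) => w; rewrite Fix_eq.
  exact: projT2 (cid (ex w _)).
move=> v g h gh; congr (step v _).
by apply: functional_extensionality_dep => t;
   apply: functional_extensionality_dep => l.
Qed.

Lemma strict_well_order_exists (T : Type) : exists lt : T -> T -> Prop,
  [/\ well_founded lt, forall x y z, lt x y -> lt y z -> lt x z &
      forall x y, [\/ lt x y, x = y | lt y x]].
Proof.
elim/Pchoice: T => T.
have [R Rwo] := wochoice.well_ordering_principle T.
have Rmin (A : set T) : A !=set0 -> exists2 z, A z & forall x, A x -> R z x.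
  move=> [x Ax]; have [|z [[zA zmin] _]] := Rwo (mem A).
    by exists x; rewrite inE.
  exists z; first by rewrite -in_setE.
  by move=> y Ay; apply: zmin; rewrite inE.
have Ranti x y : R x y -> R y x -> x = y.
  move=> Rxy Ryx; have [|z [_ zU]] := Rwo (mem [set x; y]).
    by exists x; rewrite inE; left.
  have RR w : R w w.
    have [z' -> /(_ w)] := Rmin [set w] (ex_intro _ w erefl); exact.
  have <- : z = x; last (apply: zU).
    apply: zU; split; first by rewrite inE; left.
    by move=> t; rewrite inE => -[->|->].
  split; first by rewrite inE; right.
  by move=> t; rewrite inE => -[->|->].
exists (fun x y => ~ R y x); split.
- move=> x; apply: contrapT => nx.
  have [z nz zmin] := Rmin [set x | ~ Acc (fun x y => ~ R y x) x]
    (ex_intro _ x nx).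
  apply: nz; constructor => y nRzy; apply: contrapT => /zmin; exact: nRzy.
- move=> x y z nyx nzy Rzx.
  have [m] := Rmin [set t | [\/ t = x, t = y | t = z]]
    (ex_intro _ x (Or31 _ _ erefl)).
  case=> -> mm; [|by apply: nyx; apply: mm; apply: Or31|
                 by apply: nzy; apply: mm; apply: Or32].
  have xz : x = z by apply: Ranti => //; apply: mm; apply: Or33.
  by apply: nzy; rewrite -xz; apply: mm; apply: Or32.
- move=> x y; have [Ryx|?] := pselect (R y x); last exact: Or31.
  have [Rxy|?] := pselect (R x y); last exact: Or33.
  by apply: Or32; apply: Ranti.
Qed.

(** * The ordinal omega_1 and sets of cardinality aleph_1 *)

(** These properties characterise the order type omega_1. *)
Definition omega1_order (W : Type) (lt : W -> W -> Prop) :=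
  [/\ well_founded lt,
      forall x y z, lt x y -> lt y z -> lt x z,
      forall x y, [\/ lt x y, x = y | lt y x],
      forall x, countable [set y | lt y x] &
      ~ countable [set: W]].

(** In a well-order of an uncountable set, the elements with countably many
    predecessors form an initial segment. Were it countable, the least element
    outside it would have only elements of it as predecessors, and so belong to
    it. *)
Lemma omega1_order_exists T (B : set T) : ~ countable B ->
  exists (W : Type) (lt : W -> W -> Prop), omega1_order lt.
Proof.
move=> Bunc; have [lt [wf tr tri]] := strict_well_order_exists T.
pose seg y := [set z | B z /\ lt z y].
pose G := [set y | B y /\ countable (seg y)].
exists (set_type G), (fun x y => lt (val x) (val y)); split.
- exact: (Inverse_Image.wf_inverse_image _ _ lt val wf).
- by move=> x y z; apply: tr.
- move=> x y; have [?|/val_inj ?|?] := tri (val x) (val y).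
  + exact: Or31.
  + exact: Or32.
  + exact: Or33.
- move=> x; have [_ cx] := set_valP x.
  apply: sub_countable cx.
  apply: card_le_trans (_ : val @` [set y : G | lt (val y) (val x)] #<= _).
    by apply/card_eqW/card_esym; exact: (inj_card_eq (in2W val_inj)).
  apply: subset_card_le => _ [y /= yx <-]; split=> //.
  by have [] := set_valP y.
rewrite (eq_countable (card_setT G)) => cG.
have [BG|] := pselect (B `<=` G).
  by apply: Bunc; apply: sub_countable cG; apply: subset_card_le.
move=> /existsNP[x0 /not_implyP[Bx0 nGx0]].
elim/(well_founded_ind wf): x0 Bx0 nGx0 => x IH Bx nGx.
have [sG|] := pselect (seg x `<=` G).
  apply: nGx; split=> //; apply: sub_countable cG; exact: subset_card_le.
by move=> /existsNP[z /not_implyP[[Bz zx] nGz]]; exact: (IH z).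
Qed.

Section Omega1.
Variables (W : Type) (lt : W -> W -> Prop).
Hypothesis hW : omega1_order lt.

Let wf : well_founded lt. Proof. by case: hW. Qed.
Let tr x y z : lt x y -> lt y z -> lt x z.
Proof. by case: hW => _ + _ _ _; apply. Qed.
Let tri x y : [\/ lt x y, x = y | lt y x]. Proof. by case: hW. Qed.
Let cseg x : countable [set y | lt y x]. Proof. by case: hW. Qed.
Let Wunc : ~ countable [set: W]. Proof. by case: hW. Qed.

Lemma omega1_inhabited : exists w : W, True.
Proof.
apply: contrapT => nW; apply: Wunc; suff -> : [set: W] = set0 by [].
by apply/seteqP; split=> // w _; apply: nW; exists w.
Qed.

Lemma countable_bounded (Q : set W) : countable Q ->
  exists w, forall q, Q q -> lt q w.
Proof.
move=> cQ; apply: contrapT => /forallNP nb; apply: Wunc.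
suff -> : [set: W] = \bigcup_(q in Q) ([set y | lt y q] `|` [set q]).
  apply: bigcup_countable => // q _.
  by apply: countableU => //; exact: countable1.
apply/seteqP; split=> // w _.
have /existsNP[q /not_implyP[Qq nqw]] := nb w.
by exists q => //; have [//|->|] := tri q w; [right|left].
Qed.

(** The injection is built by recursion on the value of r: each fibre is
    countable, and at each stage only countably many elements of S have been
    used, so that infinitely many remain. *)
Lemma card_le_of_countable_fibers Y Z (r : Y -> W) (S : set Z) :
  (forall w, countable (r @^-1` [set w])) -> ~ countable S ->
  [set: Y] #<= S.
Proof.
move=> cr Sunc.
have [z0 _] : S !=set0.
  by apply/set0P/eqP => S0; apply: Sunc; rewrite S0.
pose Phi w (g : forall v, lt v w -> Y -> Z) (h : Y -> Z) :=
  (forall y y', r y = w -> r y' = w -> h y = h y' -> y = y') /\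
  forall y, r y = w -> S (h y) /\
    forall v (l : lt v w) y', r y' = v -> h y <> g v l y'.
have [w g|G GP] := @wf_choice W (Y -> Z) lt Phi wf.
  pose used := \bigcup_(v in [set v | lt v w])
    [set z | exists (l : lt v w) y, r y = v /\ z = g v l y].
  have cused : countable used.
    apply: bigcup_countable => // v /= l.
    suff : [set z | exists (l : lt v w) y, r y = v /\ z = g v l y] `<=`
        g v l @` (r @^-1` [set v]).
      move=> /subset_card_le/sub_countable; apply.
      exact: sub_countable (card_image_le _ _) (cr v).
    move=> z [l' [y [ryv ->]]]; exists y => //.
    by rewrite (Prop_irrelevance l l').
  have inf : infinite_set (S `\` used).
    move=> /finite_set_countable cSu; apply: Sunc.
    apply: (@sub_countable _ _ _ ((S `\` used) `|` used)).
      apply: subset_card_le => z Sz.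
      by have [?|?] := pselect (used z); [right|left].
    exact: countableU.
  have /(card_le_exP _ _ z0)[h hS hinj] : r @^-1` [set w] #<= S `\` used.
    apply: card_le_trans (cr w) _; exact/infiniteP.
  exists h; split=> [y y' yw y'w|y yw]; first exact: hinj.
  have [Sh nused] := hS y yw; split=> // v l y' y'v hy; apply: nused.
  by exists v => //; exists l, y'.
apply/(card_le_exP _ _ z0); exists (fun y => G (r y) y).
  by move=> y _; have [_ /(_ y erefl)[]] := GP (r y).
move=> y y' _ _ e; have [_ Gy] := GP (r y); have [Gi' Gy'] := GP (r y').
have [l|ryy'|l] := tri (r y) (r y').
- by have [_ /(_ _ l y erefl)] := Gy' y' erefl; rewrite e.
- by apply: Gi' => //; rewrite -{1}ryy'.
- by have [_ /(_ _ l y' erefl)] := Gy y erefl; rewrite e.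
Qed.

Lemma omega1_card_le Z (S : set Z) : ~ countable S -> [set: W] #<= S.
Proof.
apply: (@card_le_of_countable_fibers W Z id) => w.
by rewrite preimage_id; exact: countable1.
Qed.

(** The maximum of the two coordinates has countable fibres. *)
Lemma omega1_square : [set: W * W] #<= [set: W].
Proof.
apply: (@card_le_of_countable_fibers _ _
  (fun p => if pselect (lt p.1 p.2) then p.2 else p.1)) => // w.
pose I := [set y | lt y w] `|` [set w].
have cI : countable I by apply: countableU => //; exact: countable1.
apply: sub_countable (countableX cI cI); apply: subset_card_le => -[a b] /=.
rewrite /I; case: pselect => [l|nl] /= <-; first by split; [left|right].
by split; [right|have [//|->|] := tri a b; [right|left]].
Qed.

Lemma countable_card_le T (A : set T) : countable A -> A #<= [set: W].
Proof.
move=> cA; apply: card_le_trans cA _; apply/infiniteP.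
by move=> /finite_set_countable.
Qed.

Lemma bigcup_card_le I T (D : set I) (F : I -> set T) : D #<= [set: W] ->
  (forall i, D i -> F i #<= [set: W]) -> \bigcup_(i in D) F i #<= [set: W].
Proof.
have [w0 _] := omega1_inhabited.
move=> /(card_le_exP _ _ w0)[f _ finj] FW; apply: card_le_trans omega1_square.
have /choice[g gP] : forall i, exists g : T -> W, D i ->
    forall x y, F i x -> F i y -> g x = g y -> x = y.
  move=> i; have [Di|nDi] := pselect (D i); last by exists (fun=> w0).
  by have /(card_le_exP _ _ w0)[g _ ginj] := FW i Di; exists g.
have /choice[h hP] : forall x, exists p : W * W,
    (\bigcup_(i in D) F i) x -> exists i, [/\ D i, F i x & p = (f i, g i x)].
  move=> x; have [[i Di Fx]|] := pselect ((\bigcup_(i in D) F i) x).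
    by exists (f i, g i x) => _; exists i.
  by exists (w0, w0).
apply/(card_le_exP _ _ (w0, w0)); exists h => // x y Ux Uy.
have [i [Di Fx ->]] := hP x Ux; have [j [Dj Fy ->]] := hP y Uy.
move=> [/(finj _ _ Di Dj) ij]; rewrite -ij in Fy *; exact: gP.
Qed.

Lemma cardU_le T (A B : set T) : A #<= [set: W] -> B #<= [set: W] ->
  A `|` B #<= [set: W].
Proof.
move=> cA cB; rewrite -bigcup2E; apply: bigcup_card_le.
  exact: countable_card_le.
move=> [|[|i]] //= _; exact: card_ge0.
Qed.

(** By [omega1_card_le], every uncountable set has at least as many elements as
    W; hence a set at most as large as W has size aleph_1 as soon as it is
    uncountable. *)
Lemma has_card_aleph1P T (A : set T) :
  has_card_aleph 1 A <-> ~ countable A /\ A #<= [set: W].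
Proof.
split=> [[B BN [BA nAB sub]]|[nA AW]].
  have nA : ~ countable A.
    by move=> cA; apply: nAB; exact: card_le_trans cA (card_eqW (card_esym BN)).
  split=> //.
  have [x0 _] : A !=set0 by apply/set0P/eqP => A0; apply: nA; rewrite A0.
  have /(card_le_exP _ _ x0)[f fA finj] := omega1_card_le nA.
  have fW : f @` setT #= [set: W].
    by apply: inj_card_eq => x y _ _; exact: finj.
  have [|fB|fAe] := sub (f @` setT); first by move=> _ [x _ <-]; exact: fA.
    exfalso; apply: Wunc; rewrite -(eq_countable fW).
    exact: card_le_trans fB (card_eqW BN).
  by rewrite -(card_le_eqr fW); exact: card_eqW (card_esym fAe).
have infA : infinite_set A by move=> /finite_set_countable.
have [x0 _] : A !=set0 by apply/set0P/eqP => A0; apply: nA; rewrite A0.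
have /infiniteP/(card_le_exP _ _ x0)[f fA finj] := infA.
have fN : f @` setT #= [set: nat].
  by apply: inj_card_eq => x y _ _; exact: finj.
exists (f @` setT) => //; split.
- by apply: subset_card_le => _ [x _ <-]; exact: fA.
- by move=> Af; apply: nA; exact: card_le_trans Af (card_eqW fN).
- move=> C CA; have [cC|nC] := pselect (countable C).
    by left; exact: card_le_trans cC (card_eqW (card_esym fN)).
  right; apply/card_eqPle; split; first exact: subset_card_le.
  exact: card_le_trans AW (omega1_card_le nC).
Qed.

(** The countable subsets of a set of size aleph_1 have a cofinal family of size
    aleph_1: transport the initial segments of omega_1, in which every countable
    set is bounded. This holds whatever the size of the continuum. *)
Lemma countable_cover Z (S : set Z) : S #<= [set: W] ->
  exists E : W -> set Z, (forall w, countable (E w)) /\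
    forall Q, Q `<=` S -> countable Q -> exists w, Q `<=` E w.
Proof.
have [w0 _] := omega1_inhabited.
move=> /(card_le_exP _ _ w0)[f _ finj].
exists (fun w => S `&` [set z | lt (f z) w]); split=> [w|Q QS cQ].
  apply: sub_countable (cseg w); apply/(card_le_exP _ _ w0).
  exists f => [z []//|x y [Sx _] [Sy _]]; exact: finj.
have [w wQ] := countable_bounded (sub_countable (card_image_le f Q) cQ).
by exists w => z Qz; split; [exact: QS|apply: wQ; exists z].
Qed.

(** Build an increasing sequence G of members of F indexed by omega_1: G w
    contains the union S of the earlier ones, and the image by op of each set in
    a fixed cofinal family of countable subsets of S. A countable subset of the
    union A of all G w is already contained in the union of the G v for v below
    some w, hence in a set from the cofinal family attached to w. *)
Lemma exists_closed_member Z (F : set (set Z)) (op : set Z -> set Z) :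
  ~ ([set: Z] #<= [set: W]) ->
  (forall A, F A -> A #<= [set: W]) ->
  (forall S, has_card_aleph 1 S -> exists2 A, F A & S `<=` A) ->
  (forall C, C `<=` F -> total_on C subset ->
     has_cofinality_omega1 subset C -> F (\bigcup_(A in C) A)) ->
  (forall P, countable P -> countable (op P)) ->
  exists (A : set Z) (Ps : set (set Z)),
    [/\ F A, Ps #<= [set: W],
        forall P, Ps P -> countable P /\ op P `<=` A &
        forall Q, Q `<=` A -> countable Q -> exists2 P, Ps P & Q `<=` P].
Proof.
move=> Zbig Fsmall Fcof Fchain op_countable.
have Zunc : ~ countable [set: Z] by move=> /countable_card_le.
have /choice[E EP] : forall S : set Z, exists E : W -> set Z,
    S #<= [set: W] -> (forall w, countable (E w)) /\
    forall Q, Q `<=` S -> countable Q -> exists w, Q `<=` E w.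
  move=> S; have [/countable_cover[E]|] := pselect (S #<= [set: W]).
    by exists E.
  by exists (fun=> set0).
pose below w (g : forall v, lt v w -> set Z) :=
  [set z | exists v (l : lt v w), g v l z].
pose Phi w (g : forall v, lt v w -> set Z) (A : set Z) :=
  (forall v l, F (g v l)) ->
  [/\ F A, below w g `<=` A, exists2 z, A z & ~ below w g z &
      forall a, op (E (below w g) a) `<=` A].
have below_small w g : (forall v l, F (g v l)) -> below w g #<= [set: W].
  move=> Fg; apply: (@card_le_trans _ _ _ (\bigcup_(v in [set v | lt v w])
      [set z | exists l : lt v w, g v l z])).
    by apply: subset_card_le => z [v [l glz]]; exists v => //; exists l.
  apply: bigcup_card_le; first exact: countable_card_le.
  move=> v l; apply: card_le_trans (Fsmall _ (Fg v l)).
  by apply: subset_card_le => z [l']; rewrite (Prop_irrelevance l' l).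
have [w g|G GP] := @wf_choice W (set Z) lt Phi wf.
  have [Fg|nFg] := pselect (forall v l, F (g v l)); last by exists set0.
  have bs := below_small w g Fg; have [cE _] := EP _ bs.
  have [z0 nz0] : exists z, ~ below w g z.
    apply/existsNP => bT; apply: Zbig; apply: card_le_trans bs.
    exact: subset_card_le.
  have [z1 _] : [set: Z] !=set0 by exists z0.
  have /(card_le_exP _ _ z1)[f _ finj] := omega1_card_le Zunc.
  have fW : f @` setT #= [set: W].
    by apply: inj_card_eq => x y _ _; exact: finj.
  (* The copy f @` setT of W makes N have size exactly aleph_1, and z0 makes the
     sequence strictly increasing, so that its range has cofinality omega_1. *)
  pose N := f @` setT `|` (below w g `|` [set z0] `|`
    \bigcup_(a in [set: W]) op (E (below w g) a)).
  have [|A FA NA] := Fcof N.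
    apply/has_card_aleph1P; split.
      move=> cN; apply: Wunc; rewrite -(eq_countable fW).
      by apply: sub_countable cN; apply: subset_card_le => z; left.
    apply: cardU_le; first exact: card_image_le.
    apply: cardU_le.
      apply: cardU_le => //; apply: countable_card_le; exact: countable1.
    apply: bigcup_card_le => // a _; apply: countable_card_le.
    exact: op_countable.
  exists A => _; split=> //.
  - by move=> z bz; apply: NA; right; left; left.
  - by exists z0 => //; apply: NA; right; left; right.
  - by move=> a z oz; apply: NA; right; right; exists a.
have FG w : F (G w).
  elim/(well_founded_ind wf): w => w IH.
  by have [] := GP w (fun v l => IH v l).
have {}GP w := GP w (fun v _ => FG v).
pose S w := below w (fun v _ => G v).
have SW w : S w #<= [set: W] by apply: below_small.
have GS v w : lt v w -> G v `<=` S w by move=> l z Gz; exists v, l.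
have SG w : S w `<=` G w by have [] := GP w.
pose C := range G.
(* A countable subfamily of the range of G is bounded, hence not cofinal. *)
have C_unc Q : cofinal_in subset C Q -> ~ countable Q.
  move=> [QC Qcof] cQ.
  have /choice[i iP] : forall X : set Z, exists w, Q X -> G w = X.
    move=> X; have [/QC[w _ <-]|nQ] := pselect (Q X); first by exists w.
    by have [w0 _] := omega1_inhabited; exists w0.
  have [w wQ] := countable_bounded (sub_countable (card_image_le i Q) cQ).
  have [|X QX GX] := Qcof (G w); first by exists w.
  have [_ _ [z Gz nSz] _] := GP w; apply: nSz; have /GX Xz := Gz.
  have l : lt (i X) w by apply: wQ; exists X.
  by apply: (GS _ _ l); rewrite iP.
have CW : C #<= [set: W] by exact: card_image_le.
have Ccof : cofinal_in subset C C by split=> // x Cx; exists x.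
exists (\bigcup_(A in C) A), [set E (S p.1) p.2 | p in [set: W * W]]; split.
- apply: Fchain.
  + by move=> _ [w _ <-].
  + move=> _ _ [v _ <-] [w _ <-].
    have [l|->|l] := tri v w; [left|by left|right].
      exact: subset_trans (GS _ _ l) (SG w).
    exact: subset_trans (GS _ _ l) (SG v).
  + exists C.
      split=> //; apply/has_card_aleph1P; split=> //; exact: C_unc.
    by move=> Q /C_unc/omega1_card_le; exact: card_le_trans.
- exact: card_le_trans (card_image_le _ _) omega1_square.
- move=> _ [[w a] _ <-] /=; split; first by have [] := EP _ (SW w).
  have [_ _ _ opG] := GP w.
  by move=> z /opG Gz; exists (G w) => //; exists w.
- move=> Q QA cQ.
  have /choice[i iP] : forall z, exists w, Q z -> G w z.
    move=> z; have [/QA[_ [w _ <-] Gz]|nQ] := pselect (Q z); first by exists w.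
    by have [w0 _] := omega1_inhabited; exists w0.
  have [w wQ] := countable_bounded (sub_countable (card_image_le i Q) cQ).
  have [_ /(_ Q)] := EP _ (SW w); case=> //.
    move=> z Qz; apply: (GS (i z)); last exact: iP.
    by apply: wQ; exists z.
  by move=> a Qa; exists (E (S w) a) => //; exists (w, a).
Qed.

End Omega1.

Lemma has_card_aleph_uncountable n T (A : set T) :
  has_card_aleph n.+1 A -> ~ countable A.
Proof.
elim: n A => [|n IH] A [B Bn [BA nAB _]] cA.
  exact: nAB (card_le_trans cA (card_eqW (card_esym Bn))).
exact: IH Bn (card_le_trans BA cA).
Qed.

(** * Families of pairs of sets of natural numbers *)

Definition independent_cover I (b : bool -> I -> set nat) :=
  (forall i n, b true i n \/ b false i n) /\
  forall s s' : set I, finite_set s -> finite_set s' -> s `&` s' = set0 ->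
    exists n, (forall i, s i -> ~ b true i n) /\
              (forall i, s' i -> ~ b false i n).

Lemma independent_cover_inj I (b : bool -> I -> set nat) :
  independent_cover b -> injective (b true).
Proof.
move=> [cov ind] i j bij; apply: contrapT => nij.
have [||//|n [/(_ i erefl) nbi /(_ j erefl) nbj]] := ind [set i] [set j].
- exact: finite_set1.
- exact: finite_set1.
- by apply/seteqP; split=> // k [-> /nij].
by have [] := cov j n; rewrite -?bij.
Qed.

(** For each finite list t of pairs (k, c) such that the sets e k cover the
    natural numbers, fix if possible a realization: a choice of indices f (k, c)
    with e k inside b c (f (k, c)). Any realization of t meets the fixed one,
    since two disjoint realizations f and g give, by independence, a point
    outside all b true (f (k, true)) and all b false (g (k, false)), so outside
    every e k. Hence no t is realized off the countable set K of all fixed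
    indices, so the members of e decided by indices outside K have no finite
    subcover, and x m is chosen outside those among e 0, ..., e (m - 1). *)
Lemma avoid_decided_sets I (b : bool -> I -> set nat) (e : nat -> set nat) :
  independent_cover b ->
  exists (K : set I) (x : nat -> nat), countable K /\
    forall i c k, ~ K i -> e k `<=` b c i -> forall m, (k < m)%N -> ~ e k (x m).
Proof.
move=> [_ ind].
pose covers (t : seq (nat * bool)) := forall n, exists2 q, q \in t & e q.1 n.
pose realizes (t : seq (nat * bool)) (f : nat * bool -> I) :=
  forall q, q \in t -> e q.1 `<=` b q.2 (f q).
have /choice[K KP] : forall t, exists K : set I, countable K /\
    forall f, covers t -> realizes t f -> exists2 q, q \in t & K (f q).
  move=> t.
  have [[f [ct rf]]|nf] := pselect (exists f, covers t /\ realizes t f).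
    exists (f @` [set` t]); split.
      apply: sub_countable (card_image_le _ _) _.
      exact: finite_set_countable.
    move=> g _ rg; apply: contrapT => disj.
    have [||//|n [fn gn]] := ind (f @` [set` t]) (g @` [set` t]).
    - exact: finite_image.
    - exact: finite_image.
    - apply/seteqP; split=> // i [[q qt fqi] [q' q't gq'i]].
      by apply: disj; exists q' => //; exists q; rewrite ?gq'i.
    have [[k c] qt ekn] := ct n; case: c qt ekn => qt ekn.
    + by apply: (fn (f (k, true))); [exists (k, true)|apply: (rf _ qt)].
    + by apply: (gn (g (k, false))); [exists (k, false)|apply: (rg _ qt)].
  exists set0; split=> // f ct rf; exfalso; apply: nf; by exists f.
pose K0 := \bigcup_(t in [set: seq (nat * bool)]) K t.
pose decided (q : nat * bool) := exists2 i, ~ K0 i & e q.1 `<=` b q.2 i.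
suff /choice[x xP] : forall m, exists n, forall q,
    (q.1 < m)%N -> decided q -> ~ e q.1 n.
  exists K0, x; split.
    by apply: bigcup_countable => // t _; have [] := KP t.
  by move=> i c k nKi eb m km; apply: (xP m (k, c)) => //; exists i.
move=> m; apply: contrapT => /forallNP nox.
have cov n : exists q, [/\ (q.1 < m)%N, decided q & e q.1 n].
  apply: contrapT => nq; apply: (nox n) => q qm dq en; apply: nq.
  by exists q.
have [_ [_ [i0 _ _] _]] := cov 0%N.
have /choice[f fP] : forall q, exists i,
    decided q -> ~ K0 i /\ e q.1 `<=` b q.2 i.
  move=> q; have [[i ni ei]|] := pselect (decided q); first by exists i.
  by exists i0.
pose t := [seq q <- allpairs pair (iota 0 m) [:: true; false]
          | `[< decided q >]].
have td q : q \in t -> decided q by rewrite mem_filter => /andP[/asboolP].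
have [_ Kt] := KP t.
have [||q /td/fP[nK _] Kq] := Kt f.
- move=> n; have [[k c] [/= km dq en]] := cov n; exists (k, c) => //.
  rewrite mem_filter; apply/andP; split; first exact/asboolP.
  apply/allpairsP; exists (k, c); split=> //=; first by rewrite mem_iota.
  by case: c {dq}.
- by move=> q /td/fP[].
by apply: nK; exists t.
Qed.

(** When b comes from a map onto a cube, K is the set of coordinates discarded
    for P, and T lists the tails of a convergent sequence. *)
Definition has_traps I (b : bool -> I -> set nat) :=
  forall P : set (set nat), countable P ->
    exists (K : set I) (T : nat -> set nat), countable K /\
      forall i, ~ K i -> (exists m c, T m `<=` b c i) /\
        forall c p m, P p -> p `<=` b c i -> ~ T m `<=` p.

(** * Traps contradict the ideal property *)

(** Injectivity of b true ensures that there are at least aleph_2 sets of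
    natural numbers, so that each stage of the chain can be properly enlarged. *)
Lemma aleph1_aleph0_ideal_no_traps (I : Type) (b : bool -> I -> set nat) :
  has_card_aleph 2 [set: I] -> aleph1_aleph0_ideal (set nat) ->
  injective (b true) ->
  ~ has_traps b.
Proof.
move=> [B B1 [BI nIB _]] [F [Fideal Fcard Fcof Fchain]] binj trap.
have Bunc := has_card_aleph_uncountable (n := 0) B1.
have [W [lt hW]] := omega1_order_exists Bunc.
have BW : (B #<= [set: W])%card by have /(has_card_aleph1P hW)[] := B1.
have nIW : ~ ([set: I] #<= [set: W])%card.
  by move=> IW; apply: nIB; apply: card_le_trans IW (omega1_card_le hW Bunc).
have nPW : ~ ([set: set nat] #<= [set: W])%card.
  move=> PW; apply: nIW; apply: card_le_trans PW.
  by apply/(card_le_exP _ _ set0); exists (b true) => // x y _ _ /binj.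
have /choice[KT KTP] : forall P : set (set nat),
    exists KT : set I * (nat -> set nat), countable P -> countable KT.1 /\
      forall i, ~ KT.1 i -> (exists m c, KT.2 m `<=` b c i) /\
        forall c p m, P p -> p `<=` b c i -> ~ KT.2 m `<=` p.
  move=> P; have [/trap[K [T KT]]|] := pselect (countable P).
    by exists (K, T).
  by exists (set0, fun=> set0).
have [||A [Ps [FA PsW PsA Acov]]] := exists_closed_member hW
  (op := fun P => range (KT P).2) nPW _ Fcof Fchain.
- by move=> A /Fcard/(has_card_aleph1P hW)[].
- by move=> P _; apply: sub_countable (card_image_le _ _) _.
have [i0 i0P] : exists i, forall P, Ps P -> ~ (KT P).1 i.
  apply: contrapT => /forallNP bad; apply: nIW.
  suff -> : [set: I] = \bigcup_(P in Ps) (KT P).1.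
    apply: (bigcup_card_le hW) => // P /PsA[cP _].
    by apply: (countable_card_le hW); have [] := KTP P cP.
  apply/seteqP; split=> // i _.
  have /existsNP[P /not_implyP[PsP /contrapT ?]] := bad i; by exists P.
(* If b c i0 belongs to A, it generates by itself the ideal of A below it. *)
have /choice[Q QP] : forall c, exists Q : set (set nat), [/\ countable Q,
    Q `<=` A, (forall q, Q q -> q `<=` b c i0) &
    forall a, A a -> a `<=` b c i0 -> exists2 q, Q q & a `<=` q].
  move=> c; have [Ab|nAb] := pselect (A (b c i0)).
    exists [set b c i0].
    split; [exact: countable1|by move=> _ ->|by move=> _ ->|].
    by move=> a _ ab; exists (b c i0).
  have [_ /(_ _ nAb)[Q cQ [QA Qcof]]] := Fideal A FA.
  exists Q; split=> // [q /QA[]//|q /QA[_]|a Aa ab].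
    by rewrite properEset => /properW.
  have [|q Qq] := Qcof a; last by rewrite subsetEset; exists q.
  split=> //; rewrite properEset properEneq; split=> //.
  by apply/eqP => ab'; apply: nAb; rewrite -ab'.
have [||P PsP QsubP] := Acov (Q true `|` Q false).
- have [_ QA1 _ _] := QP true; have [_ QA0 _ _] := QP false.
  by move=> q [/QA1|/QA0].
- have [cQ1 _ _ _] := QP true; have [cQ0 _ _ _] := QP false.
  exact: countableU.
have [cP TA] := PsA P PsP.
have [_ /(_ i0 (i0P P PsP))[[m [c Tb]] noT]] := KTP P cP.
have [_ _ Qb Qcof] := QP c.
have [|q Qq Tq] := Qcof _ _ Tb; first by apply: TA; exists m.
apply: (noT c q m) => //; last exact: Qb.
by apply: QsubP; case: (c) Qq; [left|right].
Qed.

(** * Traps from convergent sequences *)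

Lemma open_finite_bigcap I (X : topologicalType) (s : set I) (V : I -> set X) :
  finite_set s -> (forall i, s i -> open (V i)) -> open (\bigcap_(i in s) V i).
Proof.
elim/Pchoice: I => I in s V *; move=> fs oV.
rewrite -closedC setC_bigcap; apply: closed_bigcup => // i si.
by rewrite closedC; exact: oV.
Qed.

Lemma coordinate_continuous I (K : I -> topologicalType) (i : I) :
  continuous (fun h : prod_topology K => h i).
Proof. by elim/Pchoice: I => I in K i *; exact: proj_continuous. Qed.

(** The fibres of d are added to P before [avoid_decided_sets] is applied: every
    index decides every fibre, so the resulting sequence x leaves each fibre,
    which makes the range of d \o x infinite. A convergent sequence u of
    distinct points of this range has no tail inside a decided p in P, as x
    visits p only finitely often. *)
Lemma convergent_trap I (b : bool -> I -> set nat) (X : topologicalType)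
    (d : nat -> X) (g : bool -> I -> set X) :
  ~ countable [set: I] -> independent_cover b ->
  (forall c i, b c i = d @^-1` g c i) ->
  (forall c i, open (g c i)) -> (forall i x, g true i x \/ g false i x) ->
  (forall S, S `<=` range d -> infinite_set S ->
     contains_converging_subsequence S) ->
  has_traps b.
Proof.
move=> Iunc indb bg gopen gcov dconv P cP.
pose fiber n := [set k | d k = d n].
have [||e eP] := @countable_range _ (P `|` range fiber).
- apply: countableU => //.
  exact: sub_countable (card_image_le _ _) (countableP _).
- by exists (fiber 0%N); right; exists 0%N.
have [K [x [cK xP]]] := avoid_decided_sets e indb.
have [i0 nKi0] : exists i, ~ K i.
  apply/existsNP => KT; apply: Iunc; apply: sub_countable cK.
  exact: subset_card_le.
have fib n : exists N, forall k, (N < k)%N -> d (x k) <> d n.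
  have [N _ eN] : range e (fiber n) by rewrite -eP; right; exists n.
  exists N => k Nk dxk.
  suff [c] : exists c, fiber n `<=` b c i0.
    by rewrite -eN => /(xP _ _ _ nKi0)/(_ _ Nk); apply; rewrite eN.
  have [gn|gn] := gcov i0 (d n); [exists true|exists false];
    by rewrite bg /= => j /= ->.
have [||u [uinj uS [l ul]]] := dconv (range (d \o x)).
- by move=> _ [k _ <-]; exists (x k).
- move=> finS; apply: infinite_nat.
  have -> : [set: nat] = \bigcup_(y in range (d \o x)) [set k | d (x k) = y].
    by apply/seteqP; split=> // k _; exists (d (x k)) => //; exists k.
  apply: bigcup_finite => // _ [n _ <-] /=.
  have [N NP] := fib (x n).
  apply: (sub_finite_set _ (finite_II N.+1)) => k /= dk.
  by rewrite ltnS leqNgt; apply/negP => /NP; exact.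
pose T m := [set k | exists2 j, (m <= j)%N & d k = u j].
exists K, T; split=> // i nKi; split.
  have tail c : g c i l -> exists m, T m `<=` b c i.
    move=> gl; have := ul _ (open_nbhs_nbhs (conj (gopen c i) gl)).
    move=> [m _ mP]; exists m; rewrite bg => k [j mj dk].
    by rewrite /preimage /= dk; apply: mP.
  by have [/tail[m]|/tail[m]] := gcov i l; [exists m, true|exists m, false].
move=> c p m Pp pb Tp.
have [N _ eN] : range e p by rewrite -eP; left.
have xN k : (N < k)%N -> ~ p (x k).
  by rewrite -eN in pb *; exact: xP pb k.
have vinj : {in [set: nat] &, injective (fun j => u (m + j)%N)}.
  by move=> j j' _ _ /uinj/addnI.
apply: infinite_nat; rewrite -(eq_finite_set (inj_card_eq vinj)).
apply: (sub_finite_set _ (finite_image (d \o x) (finite_II N.+1))).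
move=> _ [j _ <-]; have [k _ dk] := uS (m + j)%N; exists k => //=.
rewrite ltnS leqNgt; apply/negP => /xN; apply; apply: Tp.
by exists (m + j)%N => //; rewrite leq_addr.
Qed.

(** * The theorem *)

Unset Implicit Arguments.

Theorem theorem3p1 (R : realType) (Omega2 : Type)
    (hOmega2 : has_card_aleph 2 [set: Omega2])
    (hPN : aleph1_aleph0_ideal (set nat))
    (X : topologicalType)
    (hXcompact : compact [set: X]) (hXhausdorff : hausdorff_space X)
    (D : set X) (hDcount : countable D) (hDdense : dense D)
    (hDconv : forall S : set X, S `<=` D -> infinite_set S ->
       contains_converging_subsequence S) :
  ~ exists f : X -> prod_topology (fun _ : Omega2 => set_type (`[0, 1] : set R)),
      continuous f /\ set_surj [set: X] setT f.
Proof.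
move=> [f [fcont fsurj]].
have in01 (c : bool) : (`[0, 1]%classic : set R) c%:R.
  by rewrite /= in_itv /=; case: c => /=; rewrite ?lexx ?ler01.
have fval (s : Omega2 -> bool) : exists x, forall i, val (f x i) = (s i)%:R.
  have [x _ fx] := fsurj (fun i => SigSub (mem_set (in01 (s i)))) I.
  by exists x => i; rewrite fx.
have [x0 _] := fval (fun=> true).
have [d0 [_ Dd0]] := hDdense setT (ex_intro _ x0 I) openT.
have [d dE] := countable_range hDcount (ex_intro _ d0 Dd0).
pose half (c : bool) : set R := [set r | if c then r < 2/3 else 1/3 < r].
pose g c i : set X := [set x | half c (val (f x i))].
pose b c i := d @^-1` g c i.
have cont i : continuous (fun x => val (f x i) : R).
  pose K := fun _ : Omega2 => set_type (`[0, 1] : set R).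
  move=> x; apply: (@continuous_comp X (K i) R (fun x => f x i) val).
    apply: (@continuous_comp X (prod_topology K) (K i) f (fun h => h i)).
      exact: fcont.
    exact: (@coordinate_continuous Omega2 K i).
  exact: initial_continuous.
have gopen c i : open (g c i).
  apply: (@open_comp _ _ _ (half c)) => [x _|]; first exact: cont.
  by case: c; [exact: open_lt|exact: open_gt].
have gcov i x : g true i x \/ g false i x.
  rewrite /g /=; have [?|h] := ltP (val (f x i)) (2/3); [by left|right].
  by apply: lt_le_trans h; lra.
have indb : independent_cover b.
  split=> [i n|s s' fs fs' ss']; first exact: gcov.
  (* The strict inequalities beyond the thresholds make V open; they exclude
     membership in the sets b. *)
  pose V := \bigcap_(i in s) [set x | 2/3 < val (f x i)] `&`
    \bigcap_(i in s') [set x | val (f x i) < 1/3].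
  have Vopen : open V.
    apply: openI; apply: open_finite_bigcap => // i _.
      by apply: (@open_comp _ _ _ [set r : R | 2/3 < r]) => [x _|];
        [exact: cont|exact: open_gt].
    by apply: (@open_comp _ _ _ [set r : R | r < 1/3]) => [x _|];
      [exact: cont|exact: open_lt].
  have [x fx] := fval (fun i => `[< s i >]).
  have Vx : V x.
    split=> i /= si; rewrite fx; first by rewrite asboolT //=; lra.
    rewrite asboolF //=; first by lra.
    by move=> si'; have : (s `&` s') i by []; rewrite ss'.
  have [y [[Vs Vs'] +]] := hDdense V (ex_intro _ x Vx) Vopen.
  rewrite dE => -[n _ dn].
  exists n; rewrite /b /g /half /= dn; split=> i.
    by move=> /Vs /= h; apply/negP; rewrite -leNgt; lra.
  by move=> /Vs' /= h; apply/negP; rewrite -leNgt; lra.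
have Iunc := has_card_aleph_uncountable (n := 1) hOmega2.
apply: (aleph1_aleph0_ideal_no_traps hOmega2 hPN (independent_cover_inj indb)).
apply: (convergent_trap Iunc indb) => //.
by rewrite -dE.
Qed.
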